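(* Consider the multiobjective composite problem $\min_{x\in\mathbb{R}^n} F(x)$ with $F=(F_1,\dots,F_m)$, $F_i=f_i+g_i$, where each $f_i:\mathbb{R}^n\to\mathbb{R}$ is twice continuously differentiable and each $g_i$ is proper, convex and lower semicontinuous. Suppose each $f_i$, $i\in[m]$, is $\mu$-strongly convex for some $\mu>0$. Let $\{x^k\}$ be the (infinite) sequence generated by the Newton-type proximal gradient method described in the context. Then $\{x^k\}$ converges to some Pareto solution $x^*$ of the problem.
   Context: Notation: $[m]=\{1,\dots,m\}$. For $u,v\in\mathbb{R}^m$, $u\preceq v$ means $v-u\in\mathbb{R}^m_+$ and $u\prec v$ means $v-u\in\mathbb{R}^m_{++}$. A point $x^*$ is a Pareto solution if there is no $x$ with $F(x)\preceq F(x^* )$ and $F(x)\neq F(x^* )$. A twice continuously differentiable $h$ is $\mu$-strongly convex if $\mu I\preceq \nabla^2 h(x)$ (in the positive semidefinite order) for all $x$. Newton-type proximal gradient method: for $x\in\mathbb{R}^n$ let $d(x)=\arg\min_{d\in\mathbb{R}^n}\max_{i\in[m]}\{\langle\nabla f_i(x),d\rangle+g_i(x+d)-g_i(x)+\tfrac12\langle d,\nabla^2 f_i(x)d\rangle\}$ and let $\theta(x)$ be the optimal value of this problem. Given $x^0\in\mathbb{R}^n$ and parameters $\sigma,\gamma\in(0,1)$, at iteration $k$ compute $d^k=d(x^k)$, $\theta^k=\theta(x^k)$, choose the stepsize $t_k\in(0,1]$ as the largest element of $\{\gamma^j: j\in\mathbb{N},\ F_i(x^k+\gamma^j d^k)-F_i(x^k)\le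 \gamma^j\sigma\theta^k \text{ for all } i\in[m]\}$, and set $x^{k+1}=x^k+t_kd^k$. Standing assumption: the method generates an infinite sequence of points that are not Pareto critical (i.e. $d^k\neq 0$ for all $k$, the method never stops). *)

(* Defs.v *)
From HB Require Import structures.
From mathcomp Require Import all_boot all_order all_algebra.
From mathcomp Require Import all_classical all_reals all_analysis.
Set Implicit Arguments. Unset Strict Implicit. Unset Printing Implicit Defensive.
Import Order.TTheory GRing.Theory Num.Theory.
Import numFieldNormedType.Exports.
Local Open Scope classical_set_scope.
Local Open Scope ring_scope.

Section Defs.
Variables (R : realType) (n m : nat).
Local Notation vec := 'rV[R]_n.

Definition dotv (u v : vec) : R := (u *m v^T) 0 0.

(* f is twice continuously differentiable with gradient gf and Hessian hf:
   Df(x) v = <gf x, v>,  D(gf)(x) v = v *m hf x  (i.e. (hf x) i j = d_i d_j f x),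
   and hf is continuous. *)
Definition C2_with (f : vec -> R) (gf : vec -> vec) (hf : vec -> 'M[R]_n) : Prop :=
  (forall x, differentiable f x /\ 'd f x = (fun v => dotv (gf x) v) :> (vec -> R)) /\
  (forall x, differentiable gf x /\ 'd gf x = (fun v => v *m hf x) :> (vec -> vec)) /\
  continuous hf.

Definition hess_strongly_convex (mu : R) (hf : vec -> 'M[R]_n) : Prop :=
  forall x v, mu * dotv v v <= dotv v (v *m hf x).

Definition proper_fun (g : vec -> \bar R) : Prop :=
  (forall x, g x != -oo%E) /\ (exists x, g x != +oo%E).

Definition convex_efun (g : vec -> \bar R) : Prop :=
  forall (x y : vec) (l : R), 0 <= l <= 1 ->
    (g (l *: x + (1 - l) *: y)%R <= l%:E * g x + (1 - l)%:E * g y)%E.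

Definition proper_convex_lsc (g : vec -> \bar R) : Prop :=
  proper_fun g /\ convex_efun g /\ lower_semicontinuous g.

Definition Fobj (f : 'I_m -> vec -> R) (g : 'I_m -> vec -> \bar R) (i : 'I_m) (x : vec)
  : \bar R := ((f i x)%:E + g i x)%E.

Definition pareto (f : 'I_m -> vec -> R) (g : 'I_m -> vec -> \bar R) (xs : vec) : Prop :=
  ~ exists x : vec, (forall i, (Fobj f g i x <= Fobj f g i xs)%E) /\
                    (exists i, Fobj f g i x != Fobj f g i xs).

Definition sub_obj (gf : 'I_m -> vec -> vec) (hf : 'I_m -> vec -> 'M[R]_n)
  (g : 'I_m -> vec -> \bar R) (x d : vec) : \bar R :=
  (\big[Order.max/-oo]_(i < m)
     ((dotv (gf i x) d)%:E + g i (x + d)%R - g i x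
        + (2^-1 * dotv d (d *m hf i x))%:E))%E.

Definition is_newton_dir gf hf g (x d : vec) : Prop :=
  forall d' : vec, (sub_obj gf hf g x d <= sub_obj gf hf g x d')%E.

Definition armijo f g (sigma : R) (x d : vec) (th : \bar R) (t : R) : Prop :=
  forall i : 'I_m, (Fobj f g i (x + t *: d)%R - Fobj f g i x <= (t * sigma)%:E * th)%E.

Definition newton_prox_seq f gf hf g (sigma gamma : R)
  (x : nat -> vec) (d : nat -> vec) (t : nat -> R) : Prop :=
  forall k,
    is_newton_dir gf hf g (x k) (d k) /\
    let th := sub_obj gf hf g (x k) (d k) in
    let S := [set s : R | exists j : nat, s = gamma ^+ j /\ armijo f g sigma (x k) (d k) th s] in
    S (t k) /\ (forall s, S s -> s <= t k) /\
    x k.+1 = x k + t k *: d k.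

End Defs.

(* Main.v *)
(* Let q_i(z) = <grad f_i(x^k), z> + g_i(x^k + z) - g_i(x^k) + <z, H_i z>/2 be
   the models at x^k and theta_k <= 0 the minimum of their maximum.  Comparing d^k
   with d^k/2 in the models gives mu/4 |d^k|^2 <= -theta_k.  The iterates stay in a
   sublevel set of a strongly convex function, hence are bounded, and so are the
   trial points x^k + (t_k/gamma) d^k because t_k d^k = x^{k+1} - x^k; a Hessian
   bound L on the corresponding ball keeps t_k away from 0.  As the F_i(x^k)
   decrease and one of them is bounded below, theta_k gets arbitrarily small.
   If F(z) <= F(x^k), testing the model with s (z - x^k), s = mu/(2L), and strong
   convexity give |z - x^k|^2 <= -C theta_k with C independent of k and z.  For
   z = x^l, l >= k, this is the Cauchy property; the limit xs satisfies
   F(xs) <= F(x^k) by lower semicontinuity, and any z with F(z) <= F(xs)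
   is within the same distance of x^k, so z = xs. *)
Require Import Defs.
From HB Require Import structures.
From mathcomp Require Import all_boot all_order all_algebra.
From mathcomp Require Import all_classical all_reals all_analysis.
From mathcomp Require Import ring lra.
Import Order.TTheory GRing.Theory Num.Theory.
Import numFieldNormedType.Exports.
Local Open Scope classical_set_scope.
Local Open Scope ring_scope.
Set Implicit Arguments.
Unset Strict Implicit.

(** * Inner product and quadratic forms on row vectors *)

Section DotProduct.
Context {R : realType} {n : nat}.
Implicit Types u v w : 'rV[R]_n.

Lemma dotvE u v : dotv u v = \sum_j u 0 j * v 0 j.
Proof. by rewrite /dotv mxE; apply: eq_bigr => j _; rewrite mxE. Qed.

Lemma dotvC u v : dotv u v = dotv v u.
Proof. by rewrite !dotvE; apply: eq_bigr => j _; rewrite mulrC. Qed.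

Lemma dotvZl (a : R) u v : dotv (a *: u) v = a * dotv u v.
Proof. by rewrite /dotv -scalemxAl mxE. Qed.

Lemma dotvZr (a : R) u v : dotv u (a *: v) = a * dotv u v.
Proof. by rewrite dotvC dotvZl dotvC. Qed.

Lemma quadfZ (a : R) u (H : 'M[R]_n) :
  dotv (a *: u) ((a *: u) *m H) = a ^+ 2 * dotv u (u *m H).
Proof. by rewrite -scalemxAl dotvZl dotvZr mulrA expr2. Qed.

Lemma dotv_ge0 v : 0 <= dotv v v.
Proof. by rewrite dotvE sumr_ge0// => j _; rewrite -expr2 sqr_ge0. Qed.

Lemma mx_norm_ge p q (H : 'M[R]_(p, q)) i j : `|H i j| <= `|H|.
Proof.
rewrite [leRHS]/Num.Def.normr /= mx_normrE.
exact: (le_bigmax _ (fun ij : 'I_p * 'I_q => `|H ij.1 ij.2|) (i, j)).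
Qed.

(** The norm on row vectors is the maximum of the absolute entries; it is attained at some entry,
    and the square of that entry is one summand of [dotv v v]. *)
Lemma sqr_norm_le_dotv v : `|v| ^+ 2 <= dotv v v.
Proof.
have [->|v0] := eqVneq `|v| 0; first by rewrite expr0n dotv_ge0.
have [[i j] /= vij] := mx_norm_neq0 v0.
have -> : `|v| = `|v i j| by [].
rewrite (ord1 i) dotvE (bigD1 j)//= real_normK ?num_real// -expr2 lerDl.
by rewrite sumr_ge0// => k _; rewrite -expr2 sqr_ge0.
Qed.

Lemma quadf_le_norm v (H : 'M[R]_n) :
  dotv v (v *m H) <= n%:R * `|H| * dotv v v.
Proof.
have vv : \sum_i v 0 i ^+ 2 = dotv v v.
  by rewrite dotvE; apply: eq_bigr => i _; rewrite expr2.
have -> : n%:R * `|H| * dotv v v =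
    \sum_(i < n) \sum_(j < n) 2^-1 * `|H| * (v 0 i ^+ 2 + v 0 j ^+ 2).
  transitivity (\sum_(i < n) (2^-1 * `|H| * (n%:R * v 0 i ^+ 2 + dotv v v))).
    rewrite -mulr_sumr big_split /= -mulr_sumr vv sumr_const card_ord.
    by rewrite -[dotv v v *+ n]mulr_natl; field.
  apply: eq_bigr => i _; rewrite -mulr_sumr big_split /= sumr_const card_ord.
  by rewrite vv -[_ ^+ 2 *+ n]mulr_natl.
rewrite dotvE exchange_big /=; apply: ler_sum => j _.
rewrite mxE mulr_sumr; apply: ler_sum => i _.
have Hij := mx_norm_ge H i j; rewrite ler_norml in Hij.
have /andP[h1 h2] := Hij.
have := mulr_ge0 (normr_ge0 H) (sqr_ge0 (v 0 i - v 0 j)).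
have := mulr_ge0 (normr_ge0 H) (sqr_ge0 (v 0 i + v 0 j)).
(* [e1] and [e2] add up to four times the termwise bound $H_{ij} v_i v_j \le |H| (v_i^2 +
   v_j^2)/2$. *)
have e1 : 0 <= (`|H| - H i j) * (v 0 i + v 0 j) ^+ 2.
  by rewrite mulr_ge0 ?sqr_ge0 ?subr_ge0.
have e2 : 0 <= (`|H| + H i j) * (v 0 i - v 0 j) ^+ 2.
  by rewrite mulr_ge0 ?sqr_ge0 //; lra.
nra.
Qed.

End DotProduct.

(** * Derivatives along lines and a second-order Taylor bound *)

Lemma is_derive_line {R : realType} {V W : normedModType R} (F : V -> W)
    (x v : V) (s : R) :
  differentiable F (x + s *: v) ->
  is_derive s 1 (fun r : R => F (x + r *: v)) ('d F (x + s *: v) v).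
Proof.
move=> dF.
have E : (fun h : R =>
           h^-1 *: ((F \o shift (x + s *: v)) (h *: v) - F (x + s *: v)))
       = (fun h : R => h^-1 *: (((fun r : R => F (x + r *: v)) \o shift s) (h *: 1)
            - (fun r : R => F (x + r *: v)) s)).
  apply/funext => h /=; congr (_ *: (F _ - _)).
  by rewrite scalerDl [h *: 1]mulr1 addrCA.
have := @diff_derivable _ _ _ F _ v dF; have := deriveE v dF.
by rewrite /derive /derivable E => <- cv; split.
Qed.

(** Subtract $\varphi'(0)s + cs^2/2$ from $\varphi$ to get [psi]. The mean value theorem gives
    $\psi(1)-\psi(0)=\psi'(s)$, and a second use, for [dphi] on $[0,s]$, gives
    $\psi'(s)=s(\varphi''(r)-c)\ge 0$. *)
Lemma taylor2_ge {R : realType} (phi dphi ddphi : R -> R) (c : R) :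
  (forall s : R, is_derive s 1 phi (dphi s)) ->
  (forall s : R, is_derive s 1 dphi (ddphi s)) ->
  (forall s, 0 <= s <= 1 -> c <= ddphi s) ->
  phi 0 + dphi 0 + c / 2 <= phi 1.
Proof.
move=> D1 D2 ddc.
have mono (a b : R) (h dh : R -> R) : a < b ->
    (forall s : R, is_derive s 1 h (dh s)) ->
    exists2 r, a < r < b & h b - h a = dh r * (b - a).
  move=> ab Dh.
  have cont : {within `[a, b], continuous h}.
    by apply: derivable_within_continuous => s _; exact: ex_derive.
  have [r] := MVT ab (fun s _ => Dh s) cont.
  by rewrite in_itv /= => rab ->; exists r.
pose psi s := phi s - (dphi 0 * s + c / 2 * s ^+ 2).
have Dpsi (s : R) : is_derive s 1 psi (dphi s - (dphi 0 + c * s)).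
  have D := is_deriveB (D1 s) (is_deriveD
    (is_deriveZ (dphi 0) (is_derive_id s 1))
    (is_deriveZ (c / 2) (is_deriveX 2 (is_derive_id s (1 : R))))).
  apply: (is_derive_eq D); rewrite /GRing.scale /= !mulr1 expr1 mulrA.
  by rewrite divfK ?pnatr_eq0.
have [s /andP[s0 s1]] := mono 0 1 psi _ ltr01 Dpsi.
have [r /andP[r0 r1] E] := mono 0 s dphi _ s0 D2.
rewrite /psi mulr0 expr0n /= subr0 mulr1 => E1.
have : c <= ddphi r by apply: ddc; lra.
nra.
Qed.

Lemma is_derive_dotv {R : realType} {n : nat} (G : R -> 'rV[R]_n) (s : R)
    (dG v : 'rV[R]_n) :
  is_derive s 1 G dG ->
  is_derive s 1 (fun r => dotv (G r) v) (dotv dG v).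
Proof.
move=> DG.
have /derivable_mxP DGj : derivable G s 1 by exact: ex_derive.
have Dj j : is_derive s 1 (v 0 j *: (fun r => G r 0 j)) (v 0 j *: dG 0 j).
  apply: is_deriveZ; split; first exact: DGj.
  by rewrite -[in RHS](@derive_val _ _ _ _ _ _ _ DG) derive_mx ?mxE//;
    exact: ex_derive.
have -> : (fun r => dotv (G r) v) = \sum_(j < n) (v 0 j *: (fun r => G r 0 j)).
  apply/funext => r; rewrite dotvE fct_sumE; apply: eq_bigr => j _.
  by rewrite mulrC.
have -> : dotv dG v = \sum_(j < n) (v 0 j *: dG 0 j).
  by rewrite dotvE; apply: eq_bigr => j _; rewrite mulrC.
exact: is_derive_sum.
Qed.

(** * Second-order bounds and strong convexity of the smooth parts *)

Section Taylor.
Context {R : realType} {n : nat}.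
Variables (f : 'rV[R]_n -> R) (gf : 'rV[R]_n -> 'rV[R]_n).
Variable (hf : 'rV[R]_n -> 'M[R]_n).
Hypothesis C2f : C2_with f gf hf.

Lemma C2_derive_line x v (s : R) :
  is_derive s 1 (fun r => f (x + r *: v)) (dotv (gf (x + s *: v)) v).
Proof.
have [df dfE] := C2f.1 (x + s *: v).
by have := is_derive_line df; rewrite dfE.
Qed.

Lemma C2_derive2_line x v (s : R) :
  is_derive s 1 (fun r => dotv (gf (x + r *: v)) v)
    (dotv v (v *m hf (x + s *: v))).
Proof.
rewrite dotvC; apply: (is_derive_dotv (G := fun r => gf (x + r *: v))).
have [dg dgE] := C2f.2.1 (x + s *: v).
by have := is_derive_line dg; rewrite dgE.
Qed.

Lemma C2_taylor_ge x v (c : R) :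
  (forall s, 0 <= s <= 1 -> c <= dotv v (v *m hf (x + s *: v))) ->
  f x + dotv (gf x) v + c / 2 <= f (x + v).
Proof.
move=> cP; have := taylor2_ge (C2_derive_line x v) (C2_derive2_line x v) cP.
by rewrite !scale0r !addr0 scale1r.
Qed.

Lemma C2_taylor_le x v (c : R) :
  (forall s, 0 <= s <= 1 -> dotv v (v *m hf (x + s *: v)) <= c) ->
  f (x + v) <= f x + dotv (gf x) v + c / 2.
Proof.
move=> cP.
(* The upper bound is the lower bound for $-f$ with constant $-c$. *)
have := taylor2_ge (c := - c) (fun s => is_deriveN (C2_derive_line x v s))
  (fun s => is_deriveN (C2_derive2_line x v s)).
rewrite /= !fctE !scale0r !addr0 scale1r => H.
have {}H : - f x - dotv (gf x) v + - c / 2 <= - f (x + v).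
  by apply: H => s s01; rewrite lerN2 cP.
lra.
Qed.

Section StrongConvexity.
Variable mu : R.
Hypothesis mu_hf : hess_strongly_convex mu hf.

Lemma strongly_convex_tangent x v :
  f x + dotv (gf x) v + mu / 2 * dotv v v <= f (x + v).
Proof.
have := @C2_taylor_ge x v (mu * dotv v v) (fun s _ => mu_hf _ v).
by rewrite mulrAC.
Qed.

(** Take the tangent inequalities at $z=x+se$ towards $x+e$ and $x$ with weights $s$ and $1-s$: the
    gradient terms cancel, and the squares add up to $s(1-s)^2+(1-s)s^2=s(1-s)$. *)
Lemma strongly_convex_segment x e (s : R) : 0 <= s <= 1 ->
  f (x + s *: e) + mu / 2 * (s * (1 - s)) * dotv e e <=
  (1 - s) * f x + s * f (x + e).
Proof.
move=> s01; set z := x + s *: e.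
have /(ler_wpM2l (_ : 0 <= 1 - s)) := strongly_convex_tangent z ((- s) *: e).
have /(ler_wpM2l (_ : 0 <= s)) := strongly_convex_tangent z ((1 - s) *: e).
have -> : z + (1 - s) *: e = x + e.
  by rewrite /z -addrA -scalerDl addrC addrC subrKC scale1r.
have -> : z + (- s) *: e = x by rewrite /z -addrA -scalerDl subrr scale0r addr0.
rewrite !(dotvZr, dotvZl) => A B.
have s0 : 0 <= s by lra.
have s1 : 0 <= 1 - s by lra.
have := A s0; have := B s1; lra.
Qed.

End StrongConvexity.
End Taylor.

(** * Compactness of balls and lower semicontinuity *)

Section CompactBounds.
Context {R : realType} {n : nat}.

Lemma norm_ball_compact (r : R) : compact [set y : 'rV[R]_n | `|y| <= r].
Proof.
apply: bounded_closed_compact.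
  exists r; split; first exact: num_real.
  by move=> M rM y /= /le_trans; apply; exact: ltW.
exact: (closed_comp (fun y _ => @norm_continuous _ _ y) (@closed_le _ r)).
Qed.

Lemma continuous_bounded_ball {V : normedModType R} (h : 'rV[R]_n -> V) (r : R) :
  continuous h -> exists M : R, forall y, `|y| <= r -> `|h y| <= M.
Proof.
move=> ch.
have /compact_bounded [M [_ MP]] : compact (h @` [set y | `|y| <= r]).
  by apply: continuous_compact (@norm_ball_compact r); exact: continuous_subspaceT.
exists (M + 1) => y yr; apply: (MP (M + 1)); first by rewrite ltrDl.
by exists y.
Qed.

Lemma quadf_bounded_ball (H : 'rV[R]_n -> 'M[R]_n) (r : R) :
  continuous H -> exists L : R, forall y v, `|y| <= r ->
    dotv v (v *m H y) <= L * dotv v v.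
Proof.
move=> /(@continuous_bounded_ball _ H r)[M MP]; exists (n%:R * M) => y v yr.
apply: le_trans (quadf_le_norm v (H y)) _.
by rewrite ler_wpM2r ?dotv_ge0// ler_wpM2l ?MP.
Qed.

(** Near each $y$ semicontinuity gives $h>a$, so every $N>-a$ satisfies $-N<h$ there; the
    near-covering form of compactness makes the threshold on $N$ uniform over the ball. *)
Lemma lsc_bounded_below_ball (h : 'rV[R]_n -> \bar R) (r : R) :
  (forall y, h y != -oo%E) -> lower_semicontinuous h ->
  exists M : R, forall y, `|y| <= r -> (M%:E < h y)%E.
Proof.
move=> hN lsch.
have /compact_near_coveringP cov := @norm_ball_compact r.
have := cov R (pinfty_nbhs R) (fun N y => ((- N)%:E < h y)%E) _.
case.
  move=> y _.
  have [a ay] : exists a : R, (a%:E < h y)%E.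
    have := hN y; case: (h y) => [b _| _|//]; last by exists 0; rewrite ltry.
    by exists (b - 1); rewrite lte_fin; lra.
  have [V Vy VP] := lsch y a ay.
  exists (V, [set N | - a < N]) => /=.
    by split=> [|]; [|exists (- a); split; [exact: num_real|]].
  move=> [z N] /= [Vz aN]; apply: lt_trans (VP z Vz); rewrite lte_fin; lra.
move=> N [_ NP]; exists (- (N + 1)) => y yr; apply: NP yr; lra.
Qed.

(** If the limit value exceeded $c$, some real $a$ would satisfy $c-f(x_s)<a<h(x_s)$. Near $x_s$
    both $h>a$ and $f>c-a$ hold, so late terms of the sequence would violate the bound. *)
Lemma lsc_sum_limit (f : 'rV[R]_n -> R) (h : 'rV[R]_n -> \bar R)
    (x : nat -> 'rV[R]_n) (xs : 'rV[R]_n) (c : R) :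
  {for xs, continuous f} -> (forall y, h y != -oo%E) -> lower_semicontinuous h ->
  x @ \oo --> xs -> (forall k, ((f (x k))%:E + h (x k) <= c%:E)%E) ->
  ((f xs)%:E + h xs <= c%:E)%E.
Proof.
move=> cf hN lsch xxs xc; rewrite leNgt; apply/negP => cxs.
have [a [a1 a2]] : exists a : R, (a%:E < h xs)%E /\ c - f xs < a.
  move: cxs (hN xs); case: (h xs) => [b|_ _|//].
    by rewrite -EFinD lte_fin => ? _; exists ((b + (c - f xs)) / 2);
      rewrite lte_fin; split; lra.
  by exists (c - f xs + 1); rewrite ltry; split=> //; lra.
have [V Vxs VP] := lsch xs a a1.
have fV : \forall y \near xs, c - a < f y.
  have := cvgr_gt _ cf; apply; lra.
have : \forall k \near \oo, False.
  near=> k; have : (a%:E < h (x k))%E by apply: VP; near: k; exact: xxs.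
  have : c - a < f (x k) by near: k; exact: xxs fV.
  have := xc k; case: (h (x k)) => [b| |//]; last by rewrite addey.
  rewrite -EFinD lee_fin lte_fin; lra.
by move=> [N _ /(_ N (leqnn N))].
Unshelve. all: by end_near. Qed.

End CompactBounds.

(** * The models and the iteration in real-valued form *)

Section NewtonProx.
Context {R : realType} {n m : nat}.
Variables (f : 'I_m -> 'rV[R]_n -> R) (gf : 'I_m -> 'rV[R]_n -> 'rV[R]_n).
Variables (hf : 'I_m -> 'rV[R]_n -> 'M[R]_n) (g : 'I_m -> 'rV[R]_n -> \bar R).
Variables (mu sigma gamma : R).
Variables (x : nat -> 'rV[R]_n) (d : nat -> 'rV[R]_n) (t : nat -> R).
Hypothesis m_gt0 : (0 < m)%N.
Hypothesis C2f : forall i, C2_with (f i) (gf i) (hf i).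
Hypothesis cvx_g : forall i, proper_convex_lsc (g i).
Hypothesis mu_gt0 : 0 < mu.
Hypothesis mu_hf : forall i, hess_strongly_convex mu (hf i).
Hypothesis sigma01 : 0 < sigma < 1.
Hypothesis gamma01 : 0 < gamma < 1.
Hypothesis g_x0 : forall i, g i (x 0%N) != +oo%E.
Hypothesis seq_x : newton_prox_seq f gf hf g sigma gamma x d t.

Let dom y := forall i, g i y \is a fin_num.
(** [fine] sends infinite values to 0, so [G], [F] and [model] carry meaning only where [g] is
    finite; this is why finiteness and [dom] accompany them below. *)
Let G i y := fine (g i y).
Let F i y := f i y + G i y.
Let model i y e :=
  dotv (gf i y) e + G i (y + e) - G i y + 2^-1 * dotv e (e *m hf i y).
Let theta k := fine (sub_obj gf hf g (x k) (d k)).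

Lemma g_neqNy i y : g i y != -oo%E.
Proof. by case: (cvx_g i) => -[]. Qed.

Lemma g_fin_numE i y : (g i y \is a fin_num) = (g i y != +oo%E).
Proof. by rewrite fin_numE g_neqNy. Qed.

Lemma FobjE i y : g i y \is a fin_num -> Fobj f g i y = (F i y)%:E.
Proof. by move=> gy; rewrite /Fobj -(fineK gy). Qed.

(** Convexity bounds the intermediate value by a finite number, which excludes $+\infty$; properness
    excludes $-\infty$. *)
Lemma g_segment i y e (s : R) : 0 <= s <= 1 ->
  g i y \is a fin_num -> g i (y + e) \is a fin_num ->
  g i (y + s *: e) \is a fin_num /\
  G i (y + s *: e) <= (1 - s) * G i y + s * G i (y + e).
Proof.
move=> s01 gy gye; have [_ [/(_ (y + e) y s s01) + _]] := cvx_g i.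
have -> : s *: (y + e) + (1 - s) *: y = y + s *: e.
  by rewrite scalerDr addrAC -scalerDl subrKC scale1r.
rewrite -(fineK gy) -(fineK gye) -/(G i y) -/(G i (y + e)) -!EFinM -EFinD => le_g.
have gz : g i (y + s *: e) \is a fin_num.
  by rewrite g_fin_numE; apply: contraTneq le_g => ->; rewrite leNgt ltry.
by split=> //; rewrite [leRHS]addrC -lee_fin [leLHS](fineK gz).
Qed.

Lemma dom_segment y e (s : R) : 0 <= s <= 1 ->
  dom y -> dom (y + e) -> dom (y + s *: e).
Proof. by move=> s01 Dy Dye i; case: (g_segment s01 (Dy i) (Dye i)). Qed.

Lemma F_segment i y e (s : R) : 0 <= s <= 1 -> dom y -> dom (y + e) ->
  F i (y + s *: e) + mu / 2 * (s * (1 - s)) * dotv e e <=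
  (1 - s) * F i y + s * F i (y + e).
Proof.
move=> s01 Dy Dye; have [_ gs] := g_segment s01 (Dy i) (Dye i).
have := strongly_convex_segment (C2f i) (mu_hf i) y e s01.
rewrite /F; lra.
Qed.

Lemma sub_obj_termE i y e : dom y -> g i (y + e) \is a fin_num ->
  ((dotv (gf i y) e)%:E + g i (y + e) - g i y
     + (2^-1 * dotv e (e *m hf i y))%:E)%E = (model i y e)%:E.
Proof. by move=> Dy gye; rewrite -(fineK (Dy i)) -(fineK gye). Qed.

Lemma sub_obj_ge_term i y e :
  ((dotv (gf i y) e)%:E + g i (y + e) - g i y
     + (2^-1 * dotv e (e *m hf i y))%:E <= sub_obj gf hf g y e)%E.
Proof. exact: (le_bigmax -oo%E (fun j => ((dotv (gf j y) e)%:E + g j (y + e)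
  - g j y + (2^-1 * dotv e (e *m hf j y))%:E)%E) i). Qed.

Lemma sub_obj_le y e (c : R) : dom y -> dom (y + e) ->
  (forall i, model i y e <= c) -> (sub_obj gf hf g y e <= c%:E)%E.
Proof.
move=> Dy Dye mc; apply: bigmax_le; first exact: leNye.
by move=> i _; rewrite sub_obj_termE// lee_fin.
Qed.

Lemma le_sub_obj y e (c : R) : dom y -> (sub_obj gf hf g y e <= c%:E)%E ->
  dom (y + e) /\ forall i, model i y e <= c.
Proof.
move=> Dy le_c.
have le_i i := le_trans (sub_obj_ge_term i y e) le_c.
have Dye : dom (y + e).
  move=> i; rewrite g_fin_numE; apply: contraTneq (le_i i) => ->.
  by rewrite -(fineK (Dy i)).
by split=> // i; have := le_i i; rewrite sub_obj_termE.
Qed.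

(** The zero direction makes every model 0, so the minimum is at most 0. It is above $-\infty$
    because the maximum runs over a nonempty index set and dominates a finite term. *)
Lemma newton_dir_fin_num y e : dom y -> is_newton_dir gf hf g y e ->
  sub_obj gf hf g y e \is a fin_num.
Proof.
move=> Dy /(_ 0) le0.
have {}le0 : (sub_obj gf hf g y e <= 0%:E)%E.
  apply: (le_trans le0); apply: sub_obj_le => //; first by rewrite addr0.
  by move=> i; rewrite /model mul0mx /dotv trmx0 !mulmx0 !mxE addr0; lra.
have [Dye _] := le_sub_obj Dy le0.
rewrite fin_numElt (le_lt_trans le0 (ltry _)) andbT.
have := sub_obj_ge_term (Ordinal m_gt0) y e.
by apply: lt_le_trans; rewrite sub_obj_termE// ltNyr.
Qed.

(** Restates one iteration in real numbers: the models at [d k], minimality of [theta k], the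
    accepted step, and, from the maximality of [t k], an index that rejects each larger power of
    [gamma]. *)
Lemma seq_armijo k : dom (x k) -> dom (x k + d k) /\
  [/\ forall i, model i (x k) (d k) <= theta k,
      (forall e c, dom (x k + e) -> (forall i, model i (x k) e <= c) -> theta k <= c),
      exists j, t k = gamma ^+ j /\
        forall i, F i (x k.+1) - F i (x k) <= t k * sigma * theta k &
      forall j, t k < gamma ^+ j -> exists i,
        gamma ^+ j * sigma * theta k < F i (x k + gamma ^+ j *: d k) - F i (x k)].
Proof.
move=> Dx; have [nd [[j [tj arm]] [tmax xS]]] := seq_x k.
have thE : (theta k)%:E = sub_obj gf hf g (x k) (d k).
  by rewrite fineK// newton_dir_fin_num.
have [Dxd md] : dom (x k + d k) /\ forall i, model i (x k) (d k) <= theta k.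
  by apply: le_sub_obj; rewrite ?thE.
have gamj l : 0 <= gamma ^+ l <= 1.
  by have /andP[/ltW g0 /ltW g1] := gamma01; rewrite exprn_ge0 ?exprn_ile1.
split=> //; split=> //.
- move=> e c Dxe mc; rewrite -lee_fin thE (le_trans (nd e))//.
  exact: sub_obj_le.
- exists j; split=> // i; rewrite xS -lee_fin.
  have Dxt : dom (x k + t k *: d k) by rewrite tj; exact: dom_segment.
  by have := arm i; rewrite !FobjE// -thE.
- move=> l tl; apply: contrapT => /forallNP no.
  have : gamma ^+ l <= t k.
    apply: tmax; exists l; split=> // i.
    have Dxl : dom (x k + gamma ^+ l *: d k) by exact: dom_segment.
    rewrite !FobjE// -thE -EFinD -EFinM lee_fin leNgt.
    exact/negP/no.
  by rewrite leNgt tl.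
Qed.

(** * Descent of the objective and boundedness of the iterates *)

Lemma theta_le k : dom (x k) -> mu / 4 * dotv (d k) (d k) <= - theta k.
Proof.
move=> Dx; have [Dxd [md tmin _ _]] := seq_armijo Dx.
have h01 : 0 <= (2^-1 : R) <= 1 by lra.
(* Halving the direction at least halves the linear part plus the increment of [G] as a bound, but
   quarters the quadratic part; relative to half the model this gains one eighth of the Hessian
   form, at least $\mu|d^k|^2/8$. *)
have := tmin (2^-1 *: d k) (theta k / 2 - mu / 8 * dotv (d k) (d k))
  (dom_segment h01 Dx Dxd).
have H i : model i (x k) (2^-1 *: d k) <=
    theta k / 2 - mu / 8 * dotv (d k) (d k).
  have [_ gs] := g_segment h01 (Dx i) (Dxd i).
  have := md i; have := mu_hf i (x k) (d k).
  by rewrite /model quadfZ dotvZr; lra.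
by move=> /(_ H); lra.
Qed.

Lemma theta_le0 k : dom (x k) -> theta k <= 0.
Proof.
move=> Dx; have := theta_le Dx.
by have := mulr_ge0 (ltW mu_gt0) (dotv_ge0 (d k)); lra.
Qed.

(** By induction: $t_k\in[0,1]$ puts $x^{k+1}$ on the segment from $x^k$ to $x^k+d^k$, and both ends
    lie in [dom]. *)
Lemma dom_seq k : dom (x k).
Proof.
elim: k => [i|k Dx]; first by rewrite g_fin_numE.
have [Dxd [_ _ [j [tj _]] _]] := seq_armijo Dx.
have [_ [_ [_ ->]]] := seq_x k.
apply: dom_segment => //; have /andP[/ltW g0 /ltW g1] := gamma01.
by rewrite tj exprn_ge0 ?exprn_ile1.
Qed.

Lemma t_gt0 k : 0 < t k.
Proof.
have [_ [_ _ [j [-> _]] _]] := seq_armijo (dom_seq k).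
by rewrite exprn_gt0//; case/andP: gamma01.
Qed.

Lemma F_decrease i k : F i (x k.+1) <= F i (x k) + t k * sigma * theta k.
Proof.
by have [_ [_ _ [j [_ /(_ i) Fi]] _]] := seq_armijo (dom_seq k); lra.
Qed.

Lemma F_nonincreasing i k l : (k <= l)%N -> F i (x l) <= F i (x k).
Proof.
move=> /subnK <-; elim: (l - k)%N => [//|j IH]; rewrite addSn.
apply: le_trans (F_decrease _ _) _; apply: le_trans IH; rewrite gerDl.
have /andP[/ltW sg0 _] := sigma01.
by rewrite mulr_ge0_le0 ?mulr_ge0 ?(ltW (t_gt0 _)) ?theta_le0//; exact: dom_seq.
Qed.

Lemma F_bounded_below_ball i (r : R) :
  exists M : R, forall y, dom y -> `|y| <= r -> M <= F i y.
Proof.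
have cf : continuous (f i).
  by move=> y; apply: differentiable_continuous; case: ((C2f i).1 y).
have [M1 M1P] := continuous_bounded_ball r cf.
have [M2 M2P] := lsc_bounded_below_ball r (@g_neqNy i) (cvx_g i).2.2.
exists (M2 - M1) => y Dy yr; rewrite /F.
have := M2P y yr; rewrite -(fineK (Dy i)) lte_fin -/(G i y).
have := M1P y yr; rewrite ler_norml; lra.
Qed.

(* If |x^k - x^0| > 1, compare F with its lower bound on the unit ball around x^0
   at the point at distance 1 from x^0 on the segment to x^k. *)
Lemma seq_bounded : exists r : R, forall k, `|x k| <= r.
Proof.
pose i0 := Ordinal m_gt0.
have [M MP] := F_bounded_below_ball i0 (`|x 0%N| + 1).
exists (`|x 0%N| + 1 + 2 * `|F i0 (x 0%N) - M| / mu) => k.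
have Q0 : 0 <= 2 * `|F i0 (x 0%N) - M| / mu.
  by rewrite divr_ge0 ?mulr_ge0// ltW.
pose e := x k - x 0%N.
have xkE : x k = x 0%N + e by rewrite /e addrC subrK.
have xke : `|x k| <= `|x 0%N| + `|e| by rewrite xkE ler_normD.
have [e1|e1] := leP `|e| 1; first lra.
have e0 : 0 < `|e| by lra.
have s01 : 0 <= `|e|^-1 <= 1 by rewrite invr_ge0 (ltW e0) invf_le1 ?ltW.
have Dx0 := dom_seq 0; have Dxk : dom (x 0%N + e) by rewrite -xkE; exact: dom_seq.
have /MP := dom_segment s01 Dx0 Dxk.
have ns : `| `|e|^-1 *: e | = 1.
  by rewrite normrZ normfV normr_id mulVf// gt_eqF.
have nz : `|x 0%N + `|e|^-1 *: e| <= `|x 0%N| + 1.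
  by rewrite -ns; exact: ler_normD.
move=> /(_ nz) lowF.
have := F_segment i0 s01 Dx0 Dxk; rewrite -xkE.
have decF := F_nonincreasing i0 (leq0n k).
move=> segF; pose Q := (`|e|^-1 * (1 - `|e|^-1)) * dotv e e.
(* With $s=1/|e|$ one has $s(1-s)|e|^2=|e|-1$, so the strong convexity gap grows linearly in $|e|$;
   comparing it with $F(x^0)-M$ yields the radius chosen above. *)
have eQ : `|e| - 1 <= Q.
  have -> : `|e| - 1 = (`|e|^-1 * (1 - `|e|^-1)) * `|e| ^+ 2.
    by field; rewrite gt_eqF.
  by rewrite ler_wpM2l ?sqr_norm_le_dotv// mulr_ge0; lra.
rewrite -[_ * _ * dotv e e]mulrA -/Q in segF.
have s_decF : `|e|^-1 * F i0 (x k) <= `|e|^-1 * F i0 (x 0%N).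
  by rewrite ler_wpM2l// invr_ge0 ltW.
have : mu / 2 * (`|e| - 1) <= F i0 (x 0%N) - M.
  have : mu / 2 * (`|e| - 1) <= mu / 2 * Q by rewrite ler_wpM2l// divr_ge0 ?ltW.
  lra.
move=> /le_trans/(_ (ler_norm _)) bound.
have : `|e| - 1 <= 2 * `|F i0 (x 0%N) - M| / mu by rewrite ler_pdivlMr//; lra.
lra.
Qed.

(** * Lower bound on the stepsizes and consequences for [theta] *)

Lemma quadf_bounded (r : R) : exists2 L : R, mu <= L &
  forall i y v, `|y| <= r -> dotv v (v *m hf i y) <= L * dotv v v.
Proof.
have /choice[L LP] i : exists L : R, forall y v, `|y| <= r ->
    dotv v (v *m hf i y) <= L * dotv v v.
  by apply: quadf_bounded_ball; case: (C2f i) => _ [].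
(* The sum dominates every [L i]; adding [mu] makes [L] positive and keeps $\mu/(2L)$ in $[0,1]$. *)
exists (mu + \sum_i `|L i|) => [|i y v yr]; first by rewrite lerDl sumr_ge0.
apply: (le_trans (LP i y v yr)); rewrite ler_wpM2r ?dotv_ge0//.
apply: (le_trans (ler_norm _)); rewrite (bigD1 i)//= addrCA lerDl addr_ge0 ?sumr_ge0//.
exact: ltW.
Qed.

(** If $t_k<1$, some index rejected $s=t_k/\gamma$. Taylor and convexity of [g] bound its increase
    by $s\theta_k+s^2L|d^k|^2/2$, and for $s<s_0$ this would pass the Armijo test. *)
Lemma t_bounded_below : exists2 tm : R, 0 < tm & forall k, tm <= t k.
Proof.
have [r rP] := seq_bounded.
have /andP[g0 g1] := gamma01; have /andP[sg0 sg1] := sigma01.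
have r0 : 0 <= r by apply: le_trans (rP 0%N).
(* The trial displacement is $(x^{k+1}-x^k)/\gamma$, of norm at most $2r/\gamma$, so this ball
   contains the whole trial segment. *)
have [L muL LP] := quadf_bounded (r + 2 * r / gamma).
have L0 : 0 < L by apply: lt_le_trans muL.
(* Chosen so that $s_0L/2=(1-\sigma)\mu/4$, which matches the constant of [theta_le]. *)
pose s0 := (1 - sigma) * mu / (2 * L).
have s00 : 0 < s0 by rewrite divr_gt0 ?mulr_gt0 ?subr_gt0.
exists (gamma * s0) => [|k]; first by rewrite mulr_gt0.
have Dx := dom_seq k; have [Dxd [md _ [j [tj _]] tmax]] := seq_armijo Dx.
case: j tj => [|j] tj.
  rewrite tj expr0.
  have : s0 <= 1 by rewrite ler_pdivrMr ?mulr_gt0// mul1r; nra.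
  by move=> ?; nra.
rewrite tj exprS ler_pM2l//; set s := gamma ^+ j.
have sp : 0 < s by rewrite exprn_gt0.
have s1 : s <= 1 by rewrite exprn_ile1 ?ltW.
have [|i] := tmax j; first by rewrite tj exprS gtr_pMl.
rewrite -/s => noarm; rewrite leNgt; apply/negP => ss0.
have sdE : s *: d k = gamma^-1 *: (x k.+1 - x k).
  have [_ [_ [_ ->]]] := seq_x k.
  by rewrite addrAC subrr add0r scalerA tj exprS mulKf// gt_eqF.
have sd : `|s *: d k| <= 2 * r / gamma.
  rewrite sdE normrZ gtr0_norm ?invr_gt0// mulrC ler_pM2r ?invr_gt0//.
  by apply: (le_trans (ler_normB _ _)); have := rP k; have := rP k.+1; lra.
have s01 : 0 <= s <= 1 by rewrite (ltW sp).
have [_ gs] := g_segment s01 (Dx i) (Dxd i).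
have := C2_taylor_le (C2f i) (x := x k) (v := s *: d k)
  (c := s ^+ 2 * (L * dotv (d k) (d k))).
have H u : 0 <= u <= 1 -> dotv (s *: d k) ((s *: d k) *m hf i (x k + u *: (s *: d k)))
   <= s ^+ 2 * (L * dotv (d k) (d k)).
  move=> /andP[u0 u1]; rewrite quadfZ ler_wpM2l ?sqr_ge0//; apply: LP.
  apply: (le_trans (ler_normD _ _)); apply: lerD; first exact: rP.
  apply: le_trans sd; rewrite normrZ ger0_norm//.
  exact: ler_piMl.
move=> /(_ H); rewrite dotvZr => tay.
have := mu_hf i (x k) (d k); have := md i; rewrite /model => mdi q.
have dd0 := dotv_ge0 (d k); have := theta_le Dx => th.
(* Dropping this nonnegative term from the model bounds the linear part plus the increment of [G] by
   [theta k]. *)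
have q0 : 0 <= dotv (d k) (d k *m hf i (x k)).
  by apply: le_trans q; rewrite mulr_ge0// ltW.
have up : F i (x k + s *: d k) - F i (x k) <=
    s * theta k + s ^+ 2 * (L * dotv (d k) (d k)) / 2.
  have : s * (dotv (gf i (x k)) (d k) + G i (x k + d k) - G i (x k)) <= s * theta k.
    by rewrite ler_pM2l//; lra.
  rewrite /F; lra.
have : s ^+ 2 * (L * dotv (d k) (d k)) / 2 <= s * ((1 - sigma) * - theta k).
  rewrite expr2 -2!mulrA ler_pM2l//.
  apply: (@le_trans _ _ (s0 * (L * dotv (d k) (d k) / 2))).
    by rewrite ler_wpM2r ?(ltW ss0)// divr_ge0 ?mulr_ge0// ltW.
  have -> : s0 * (L * dotv (d k) (d k) / 2) =
      (1 - sigma) * (mu / 4 * dotv (d k) (d k)).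
    by rewrite /s0; field; rewrite gt_eqF.
  by rewrite ler_wpM2l// subr_ge0 ltW.
lra.
Qed.

(** Otherwise each step would lower $F_{i_0}$ by at least the fixed amount $t_m\sigma e$, against
    its lower bound on the ball containing the iterates. A single such [k] suffices later, since the
    sublevel sets of the iterates are nested. *)
Lemma theta_small (e : R) : 0 < e -> exists k, - theta k < e.
Proof.
move=> e0; apply: contrapT => /forallNP no.
have {}no k : e <= - theta k by rewrite leNgt; apply/negP/no.
have [tm tm0 tmP] := t_bounded_below; have [r rP] := seq_bounded.
pose i0 := Ordinal m_gt0; have [M MP] := F_bounded_below_ball i0 r.
have /andP[sg0 sg1] := sigma01.
pose c := tm * sigma * e; have c0 : 0 < c by rewrite !mulr_gt0.
have dec k : F i0 (x k) <= F i0 (x 0%N) - k%:R * c.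
  elim: k => [|k IH]; first by rewrite mul0r subr0.
  apply: le_trans (F_decrease _ _) _; rewrite -natr1 mulrDl mul1r.
  have : c <= t k * sigma * - theta k.
    by apply: ler_pM => //; [rewrite mulr_ge0 ?ltW|exact: ltW|rewrite ler_wpM2r// ltW].
  lra.
have [k kP] : exists k : nat, (F i0 (x 0%N) - M) / c < k%:R.
  exists (Num.truncn `|(F i0 (x 0%N) - M) / c|).+1.
  by apply: le_lt_trans (ler_norm _) _; exact: truncnS_gt.
move: kP; rewrite ltr_pdivrMr//.
have := MP _ (dom_seq k) (rP k); have := dec k; lra.
Qed.

(** For $e=z-x^k$, the tangent inequality and $F(z)\le F(x^k)$ bound the linear part plus the
    increment of [G] by $-\mu|e|^2/2$; the model at $se$ is then at most $-s\mu|e|^2/4$, and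
    [theta k] lies below that. *)
Lemma sublevel_diameter : exists2 C : R, 0 < C & forall k z, dom z ->
  (forall i, F i z <= F i (x k)) -> `|z - x k| ^+ 2 <= C * - theta k.
Proof.
have [r rP] := seq_bounded; have [L muL LP] := quadf_bounded r.
have L0 : 0 < L by apply: lt_le_trans muL.
(* With $sL=\mu/2$ the quadratic term costs at most half of the linear gain $s\mu|e|^2/2$. *)
pose s := mu / (2 * L); have s0 : 0 < s by rewrite divr_gt0 ?mulr_gt0.
have s01 : 0 <= s <= 1.
  by rewrite (ltW s0)/= ler_pdivrMr ?mulr_gt0// mul1r; lra.
have c0 : 0 < s * mu / 4 by rewrite divr_gt0 ?ltr0n// (mulr_gt0 s0).
exists (s * mu / 4)^-1 => [|k z Dz zP]; first by rewrite invr_gt0.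
have Dx := dom_seq k; have [_ [_ tmin _ _]] := seq_armijo Dx.
rewrite mulrC ler_pdivlMr//; pose e := z - x k.
have zE : z = x k + e by rewrite /e addrC subrK.
have Dxe : dom (x k + e) by rewrite -zE.
apply: (@le_trans _ _ (s * mu / 4 * dotv e e)).
  by rewrite mulrC ler_pM2l// sqr_norm_le_dotv.
rewrite lerNr; apply: (tmin _ _ (dom_segment s01 Dx Dxe)) => i.
have [_ gs] := g_segment s01 (Dx i) (Dxe i).
have q := LP i (x k) e (rP k).
have tang := strongly_convex_tangent (C2f i) (mu_hf i) (x k) e.
have := zP i; rewrite /F /model quadfZ dotvZr zE => FF.
have sle : s * (dotv (gf i (x k)) e + G i (x k + e) - G i (x k)) <=
    s * (- (mu / 2 * dotv e e)) by rewrite ler_pM2l//; lra.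
have : s ^+ 2 * dotv e (e *m hf i (x k)) <= s * (mu / 2 * dotv e e).
  rewrite expr2 -mulrA ler_pM2l//; apply: le_trans (ler_wpM2l (ltW s0) q) _.
  rewrite mulrA (_ : s * L = mu / 2)//.
  by rewrite /s; field; rewrite gt_eqF.
lra.
Qed.

(** * Convergence and Pareto optimality of the limit *)

Lemma seq_cvg : cvg (x @ \oo).
Proof.
have [C C0 CP] := sublevel_diameter.
apply: cauchy_cvg; apply: cauchy_exP => e e0.
have [k kP] : exists k, - theta k < e ^+ 2 / C.
  by apply: theta_small; rewrite divr_gt0 ?exprn_gt0.
(* The iterate [x k] serves as the centre of a ball of radius [e] containing all later iterates. *)
exists (x k); exists k => // l /= kl.
rewrite -ball_normE /= distrC -(ltr_pXn2r (n := 2))// ?nnegrE ?(ltW e0)//.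
apply: le_lt_trans (CP k (x l) (dom_seq l) _) _.
  by move=> i; exact: F_nonincreasing.
by rewrite mulrC -ltr_pdivlMr.
Qed.

(** For every [e], both points lie within [e / 2] of one common iterate [x k]. *)
Lemma sublevel_eq z w : dom z -> dom w ->
  (forall k i, F i z <= F i (x k)) -> (forall k i, F i w <= F i (x k)) -> z = w.
Proof.
move=> Dz Dw zP wP; have [C C0 CP] := sublevel_diameter.
apply/eqP; rewrite -subr_eq0 -normr_le0; apply/ler_addgt0Pr => e e0; rewrite add0r.
have [k kP] : exists k, - theta k < (e / 2) ^+ 2 / C.
  by apply: theta_small; rewrite divr_gt0 ?exprn_gt0 ?divr_gt0.
have near y : dom y -> (forall i, F i y <= F i (x k)) -> `|y - x k| <= e / 2.
  move=> Dy yP; rewrite -(ler_pXn2r (n := 2))// ?nnegrE ?divr_ge0 ?(ltW e0)//.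
  apply: (le_trans (CP k y Dy yP)); apply: ltW.
  by rewrite mulrC -ltr_pdivlMr.
rewrite (splitr e) -(subrKA (x k)); apply: le_trans (ler_normD _ _) _.
by rewrite lerD ?near// distrC near.
Qed.

Lemma seq_limit_pareto : exists xs, x @ \oo --> xs /\ pareto f g xs.
Proof.
have /cvg_ex[xs xxs] := seq_cvg; exists xs; split=> //.
have le_xs k i : (Fobj f g i xs <= (F i (x k))%:E)%E.
  (* Shifting by [k] makes the bound $F_i(x^k)$ valid for every term, as [lsc_sum_limit] asks. *)
  have xkxs : (fun l => x (l + k)%N) @ \oo --> xs by exact: cvg_comp (cvg_addnr k) xxs.
  apply: (lsc_sum_limit (x := fun l => x (l + k)%N)) => //.
  - by apply: differentiable_continuous; case: ((C2f i).1 xs).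
  - exact: g_neqNy.
  - by case: (cvx_g i) => _ [].
  - move=> l; rewrite -/(Fobj f g i _) FobjE ?lee_fin; last exact: dom_seq.
    by apply: F_nonincreasing; rewrite leq_addl.
have fin_le i y (c : R) : (Fobj f g i y <= c%:E)%E ->
    g i y \is a fin_num /\ F i y <= c.
  move=> yc; have gy : g i y \is a fin_num.
    by rewrite g_fin_numE; apply: contraTneq yc; rewrite /Fobj => ->.
  by split=> //; rewrite -lee_fin -FobjE.
have Dxs : dom xs by move=> i; case: (fin_le i xs _ (le_xs 0%N i)).
(* A dominating [z] lies below all iterates, as does [xs]; hence [z = xs], which contradicts the
   differing objective at [i]. *)
move=> [z [zxs [i]]]; apply/negP/negPn/eqP; congr (Fobj f g i _).
have zx k j : (Fobj f g j z <= (F j (x k))%:E)%E := le_trans (zxs j) (le_xs k j).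
apply: sublevel_eq => // [j|k j|k j].
- by case: (fin_le j z _ (zx 0%N j)).
- by case: (fin_le j z _ (zx k j)).
- by case: (fin_le j xs _ (le_xs k j)).
Qed.

End NewtonProx.

Unset Implicit Arguments.
Set Strict Implicit.

Theorem theorem2 (R : realType) (n m : nat)
  (f : 'I_m -> 'rV[R]_n -> R) (gf : 'I_m -> 'rV[R]_n -> 'rV[R]_n)
  (hf : 'I_m -> 'rV[R]_n -> 'M[R]_n) (g : 'I_m -> 'rV[R]_n -> \bar R)
  (mu sigma gamma : R)
  (x : nat -> 'rV[R]_n) (d : nat -> 'rV[R]_n) (t : nat -> R) :
  (0 < m)%N ->
  (forall i, C2_with (f i) (gf i) (hf i)) ->
  (forall i, proper_convex_lsc (g i)) ->
  0 < mu -> (forall i, hess_strongly_convex mu (hf i)) ->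
  0 < sigma < 1 -> 0 < gamma < 1 ->
  (forall i, g i (x 0%N) != +oo%E) ->
  newton_prox_seq f gf hf g sigma gamma x d t ->
  (forall k, d k != 0) ->
  exists xs : 'rV[R]_n, x @ \oo --> xs /\ pareto f g xs.
Proof.
move=> m_gt0 C2f cvx_g mu_gt0 mu_hf sigma01 gamma01 g_x0 seq_x _.
exact: (seq_limit_pareto m_gt0 C2f cvx_g mu_gt0 mu_hf sigma01 gamma01 g_x0 seq_x).
Qed.
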